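(* For every $1\le p\le\infty$ there are arbitrarily large integers $n$ for which there exists an $n$-point subset $X$ of $L_p$ such that for every integer $d\ge 1$, any linear embedding of $X$ into $\ell_p^d$ incurs distortion at least $$\left(\frac{n-1}{2d}\right)^{\left|1/p-1/2\right|}.$$
   Context: $L_p$ denotes the real space $L_p[0,1]$ with its usual norm, $\ell_p^d$ is $\mathbb{R}^d$ with the $\ell_p$ norm, and $1/\infty=0$. A linear embedding of a set $X\subseteq L_p$ into a normed space $Y$ is the restriction to $X$ of a linear operator $T:L_p\to Y$. Its distortion is the least $D$ such that for some $s>0$, $s\|x-y\|_p\le\|T(x)-T(y)\|_Y\le D s\|x-y\|_p$ for all $x,y\in X$ ($D=\infty$ if there is none). *)

(* Defs.v *)
From HB Require Import structures.
From mathcomp Require Import all_boot all_order all_algebra.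
From mathcomp Require Import all_classical all_reals all_analysis.
From mathcomp Require Import measurable_realfun ess_sup_inf hoelder.

Set Implicit Arguments.
Unset Strict Implicit.
Unset Printing Implicit Defensive.
Import Order.TTheory GRing.Theory Num.Theory.
Import numFieldNormedType.Exports.

Local Open Scope classical_set_scope.
Local Open Scope ring_scope.

(* The quotient L^p space [LspaceType mu p1] (classes of p-integrable         *)
(* functions modulo a.e. equality) comes without algebraic structure. It is   *)
(* made an [lmodType R] by transporting the operations of the [lmodType]      *)
(* [LfunType mu p1], whose elements are functions.                            *)
Section Lspace_lmodule.
Context d (T : measurableType d) (R : realType).
Variables (mu : {measure set T -> \bar R}) (p : \bar R) (p1 : (1 <= p)%E).

Lemma ae_eq_Lnorm (f g : T -> R) :
    measurable_fun setT f -> measurable_fun setT g -> f = g %[ae mu] ->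
  'N[mu]_p[EFin \o f]%E = 'N[mu]_p[EFin \o g]%E.
Proof.
move=> mf mg fg; rewrite unlock; case: p p1 => [r|_|//].
- rewrite lee_fin => r1; congr (_ `^ _)%E; apply: ae_eq_integral => //.
  + apply/measurable_EFinP/(@measurableT_comp _ _ _ _ _ _ (@powR R ^~ r)) => //.
    exact: measurableT_comp.
  + apply/measurable_EFinP/(@measurableT_comp _ _ _ _ _ _ (@powR R ^~ r)) => //.
    exact: measurableT_comp.
  + by apply: filterS fg => x /= /(_ I) ->.
- case: ifP => // _; apply: eq_ess_sup.
  by apply: filterS fg => x /= /(_ I) ->.
Qed.

Lemma measurable_Lspace (f : LspaceType mu p1) :
  measurable_fun setT (f : T -> R).
Proof.
pose f' : {mfun_ mu, T >-> measurableTypeR R} := f.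
exact: (@measurable_funPT _ _ _ _ (repr f')).
Qed.

Lemma Lspace_Lfun (f : LspaceType mu p1) : (f : T -> R) \in Lfun mu p.
Proof.
rewrite !inE/=; apply/andP; split; rewrite inE/=; first exact: measurable_Lspace.
exact: Lebesgue_finite.
Qed.

Definition Lspace_repr (f : LspaceType mu p1) : LfunType mu p1 :=
  Lfun_Sub p1 (Lspace_Lfun f).

(* [R] and [measurableTypeR R] carry the Borel sets under different displays, *)
(* and [LspaceType] is built on the latter.                                   *)
Let as_mfun (f : LfunType mu p1) : T -> measurableTypeR R := f.

Let measurable_as_mfun f : measurable_fun setT (as_mfun f).
Proof. exact: (@measurable_funPT _ _ _ _ f). Qed.

HB.instance Definition _ f := isMeasurableFun.Build d _ T (measurableTypeR R)
  (as_mfun f) (measurable_as_mfun f).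

Definition mfun_class (f : LfunType mu p1) :
    {mfun_ mu, T >-> measurableTypeR R} :=
  (\pi_({mfun_ mu, T >-> measurableTypeR R}) (as_mfun f))%qT.

Lemma mfun_classE (f : LfunType mu p1) :
  (mfun_class f : T -> R) = f %[ae mu].
Proof.
suff /eqmodP/asboolP : (repr (mfun_class f) =
  (as_mfun f : {mfun T >-> measurableTypeR R})
  %[mod {mfun_ mu, T >-> measurableTypeR R}])%qT by [].
by rewrite reprK.
Qed.

Lemma mfun_class_finite (f : LfunType mu p1) : finite_norm mu p (mfun_class f).
Proof.
rewrite /finite_norm (@ae_eq_Lnorm _ f _ _ (mfun_classE f))//.
  exact: Lfunction_finite.
exact: (@measurable_funPT _ _ _ _ (repr (mfun_class f))).
Qed.

Definition Lspace_class (f : LfunType mu p1) : LspaceType mu p1 :=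
  LebesgueSpace.Pack (LebesgueSpace.Class
    (isFinLebesgue.Build d T R mu p p1 (mfun_class f) (mfun_class_finite f))).


Lemma Lspace_classE (f : LfunType mu p1) :
  (Lspace_class f : T -> R) = f %[ae mu].
Proof. exact: mfun_classE. Qed.

Lemma Lspace_reprE (f : LspaceType mu p1) x : Lspace_repr f x = f x.
Proof. by []. Qed.

Lemma Lspace_eqP (f g : LspaceType mu p1) : f = g <-> (f : T -> R) = g %[ae mu].
Proof.
split=> [->|fg]; first exact: aeW.
have {fg} : (f : {mfun_ mu, T >-> measurableTypeR R}) = g.
  rewrite -[LHS]reprK -[RHS]reprK.
  by apply/eqP; rewrite eqmodE; apply/asboolP.
case: f g => [f [[Hf]]] [g [[Hg]]] /= fg.
by move: Hg; rewrite -fg => Hg; rewrite (Prop_irrelevance Hf Hg).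
Qed.

Lemma Lspace_class_eqP (f g : LfunType mu p1) :
  Lspace_class f = Lspace_class g <-> (f : T -> R) = g %[ae mu].
Proof.
split=> [/Lspace_eqP fg|fg].
  apply: filterS3 (Lspace_classE f) (Lspace_classE g) fg => x.
  by move=> /(_ I) <- /(_ I) <- /(_ I) + _.
apply/Lspace_eqP.
apply: filterS3 (Lspace_classE f) (Lspace_classE g) fg => x.
by move=> /(_ I) -> /(_ I) -> /(_ I) + _.
Qed.

Lemma Lspace_reprK : cancel Lspace_repr Lspace_class.
Proof. by move=> f; apply/Lspace_eqP; exact: Lspace_classE. Qed.

Lemma Lspace_classK (f : LfunType mu p1) :
  (Lspace_repr (Lspace_class f) : T -> R) = f %[ae mu].
Proof. exact: Lspace_classE. Qed.

Definition Lspace_add (f g : LspaceType mu p1) : LspaceType mu p1 :=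
  Lspace_class (Lspace_repr f + Lspace_repr g).

Definition Lspace_opp (f : LspaceType mu p1) : LspaceType mu p1 :=
  Lspace_class (- Lspace_repr f).

Definition Lspace_scale (a : R) (f : LspaceType mu p1) : LspaceType mu p1 :=
  Lspace_class (a *: Lspace_repr f).

Lemma Lspace_classD (f g : LfunType mu p1) :
  Lspace_class (f + g) = Lspace_add (Lspace_class f) (Lspace_class g).
Proof.
apply/Lspace_class_eqP.
apply: filterS2 (Lspace_classK f) (Lspace_classK g) => x /(_ I) fx /(_ I) gx _.
by transitivity (f x + g x) => //; rewrite -fx -gx.
Qed.

Lemma Lspace_classN (f : LfunType mu p1) :
  Lspace_class (- f) = Lspace_opp (Lspace_class f).
Proof.
apply/Lspace_class_eqP.
apply: filterS (Lspace_classK f) => x /(_ I) fx _.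
by transitivity (- f x) => //; rewrite -fx.
Qed.

Lemma Lspace_classZ (a : R) (f : LfunType mu p1) :
  Lspace_class (a *: f) = Lspace_scale a (Lspace_class f).
Proof.
apply/Lspace_class_eqP.
apply: filterS (Lspace_classK f) => x /(_ I) fx _.
by transitivity (a * f x) => //; rewrite -fx.
Qed.

HB.instance Definition _ := gen_eqMixin (LspaceType mu p1).
HB.instance Definition _ := gen_choiceMixin (LspaceType mu p1).

Let addA : associative Lspace_add.
Proof.
move=> f g h; rewrite -(Lspace_reprK f) -(Lspace_reprK g) -(Lspace_reprK h).
by rewrite -!Lspace_classD addrA.
Qed.

Let addC : commutative Lspace_add.
Proof. by move=> f g; rewrite /Lspace_add addrC. Qed.

Let add0 : left_id (Lspace_class 0) Lspace_add.
Proof. by move=> f; rewrite -(Lspace_reprK f) -Lspace_classD add0r. Qed.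

Let addN : left_inverse (Lspace_class 0) Lspace_opp Lspace_add.
Proof.
by move=> f; rewrite -(Lspace_reprK f) -Lspace_classN -Lspace_classD addNr.
Qed.

HB.instance Definition _ := GRing.isZmodule.Build (LspaceType mu p1)
  addA addC add0 addN.

Let scaleA a b f : Lspace_scale a (Lspace_scale b f) = Lspace_scale (a * b) f.
Proof. by rewrite -(Lspace_reprK f) -!Lspace_classZ scalerA. Qed.

Let scale1 : left_id 1 Lspace_scale.
Proof. by move=> f; rewrite -(Lspace_reprK f) -Lspace_classZ scale1r. Qed.

Let scaleDr : right_distributive Lspace_scale +%R.
Proof.
move=> a f g; rewrite -[f]Lspace_reprK -[g]Lspace_reprK.
rewrite -[X in Lspace_scale a X]Lspace_classD -!Lspace_classZ scalerDr.
exact: Lspace_classD.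
Qed.

Let scaleDl f : {morph Lspace_scale^~ f : a b / a + b}.
Proof.
move=> a b; rewrite -[f]Lspace_reprK -!Lspace_classZ scalerDl.
exact: Lspace_classD.
Qed.

HB.instance Definition _ := GRing.Zmodule_isLmodule.Build R (LspaceType mu p1)
  scaleA scale1 scaleDr scaleDl.

Lemma Lspace_class_is_linear : linear Lspace_class.
Proof. by move=> a f g; rewrite Lspace_classD Lspace_classZ. Qed.

HB.instance Definition _ := GRing.isLinear.Build R (LfunType mu p1)
  (LspaceType mu p1) _ Lspace_class Lspace_class_is_linear.

Definition Lspace_norm (f : LspaceType mu p1) : R :=
  fine ('N[mu]_p[EFin \o f])%E.

Lemma Lspace_norm_class (f : LfunType mu p1) :
  (Lspace_norm (Lspace_class f))%:E = 'N[mu]_p[EFin \o f]%E.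
Proof.
rewrite /Lspace_norm (ae_eq_Lnorm (measurable_Lspace _) _ (Lspace_classE f))//.
exact: finite_norm_fine.
Qed.

End Lspace_lmodule.

Section L_p.
Context (R : realType).

(* Functions on [0, 1] are represented by functions on R modulo equality a.e. *)
(* for the Lebesgue measure carried by [0, 1].                                *)
Definition lebesgue01 : set (measurableTypeR R) -> \bar R :=
  mrestr lebesgue_measure (measurable_itv `[0, 1]).

HB.instance Definition _ := Measure.on lebesgue01.

Definition Lp (p : \bar R) (p1 : (1 <= p)%E) := LspaceType lebesgue01 p1.

HB.instance Definition _ (p : \bar R) (p1 : (1 <= p)%E) :=
  GRing.Lmodule.on (Lp p1).

Definition Lp_norm (p : \bar R) (p1 : (1 <= p)%E) (f : Lp p1) : R :=
  Lspace_norm f.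

(* Meaningful for 1 <= p; the branch -oo is unused.                           *)
Definition ellp_norm (p : \bar R) (d : nat) (v : 'rV[R]_d) : R :=
  match p with
  | r%:E => (\sum_(i < d) `|v 0 i| `^ r) `^ r^-1
  | +oo%E => \big[Num.max/0]_(i < d) `|v 0 i|
  | -oo%E => 0
  end.

(* The distortion is +oo when no D is admissible (the infimum of the empty    *)
(* set). When X has two distinct points, the infimum is attained as soon as   *)
(* it is finite; D is not restricted in sign, since any admissible D is then  *)
(* at least 1.                                                                *)
Definition distortion (V W : lmodType R) (normV : V -> R) (normW : W -> R)
    (X : set V) (f : V -> W) : \bar R :=
  ereal_inf [set D%:E | D in [set D : R | exists2 s : R, 0 < s &
    forall x y, X x -> X y ->
      s * normV (x - y) <= normW (f x - f y) <= D * s * normV (x - y)]].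

End L_p.

Arguments Lp_norm {R p p1} f.
Arguments ellp_norm {R} p {d} v.

(* Main.v *)
Require Import Defs.
From HB Require Import structures.
From mathcomp Require Import all_boot all_order all_algebra.
From mathcomp Require Import all_classical all_reals all_analysis.
From mathcomp Require Import measurable_realfun ess_sup_inf.
From mathcomp Require Import ring lra.

Set Implicit Arguments.
Unset Strict Implicit.
Unset Printing Implicit Defensive.
Import Order.TTheory GRing.Theory Num.Theory.
Import numFieldNormedType.Exports.

Local Open Scope classical_set_scope.
Local Open Scope ring_scope.

(* Let k be a power of 2, H a k x k Hadamard matrix with rows w_i, and X the
   set of 2k+1 points 0, e_l, w_i of l_p^k, a space that step functions embed in
   L_p isometrically up to scaling. For T linear with values in l_2^d, the
   identity H^T H = k gives sum_i |T w_i|_2^2 = k sum_l |T e_l|_2^2. Replacing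
   the l_2 norms by l_p norms costs a factor d^|1/p-1/2|, whereas |w_i|_p =
   k^(1/p) differs from k^(1/2) |e_l|_p by a factor k^|1/p-1/2|. *)

(** * Comparison of the l_p norms on R^d *)

(** Bernoulli's inequality, obtained for a > 1 from Young's inequality for the product x * 1 with
    exponents a and its conjugate: x <= x^a / a + (1 - 1/a). *)
Lemma powR_ge_tangent (R : realType) (x a : R) :
  0 <= x -> 1 <= a -> a * (x - 1) <= x `^ a - 1.
Proof.
move=> x0; rewrite le_eqVlt => /predU1P[<-|a1]; first by rewrite mul1r powRr1.
have a0 : 0 < a by rewrite (lt_trans _ a1).
have an0 := lt0r_neq0 a0.
have b0 : 0 < 1 - a^-1 by rewrite subr_gt0 invf_lt1.
have := @conjugate_powR R x 1 a (1 - a^-1)^-1 x0 ler01 a0.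
rewrite invr_gt0 invrK subrKC powR1 => /(_ b0 erefl).
rewrite mulr1 mul1r => xa.
have := ler_wpM2l (ltW a0) xa; rewrite mulrDr mulrCA mulfV// mulr1 mulrBr mulr1.
by rewrite mulfV// mulrBr mulr1 => h; lra.
Qed.

Section ellp_norm_comparison.
Context (R : realType) (d : nat).
Implicit Types (v : 'rV[R]_d) (q r : R) (p : \bar R).

Lemma ellp_norm_ge0 p v : 0 <= ellp_norm p v.
Proof.
case: p => [r||] //=; first exact: powR_ge0.
by elim/big_ind: _ => // x y x0 y0; rewrite le_max x0.
Qed.

Lemma ellp_norm_powR q v : q != 0 ->
  ellp_norm q%:E v `^ q = \sum_(i < d) `|v 0 i| `^ q.
Proof.
move=> q0; rewrite /= -powRrM mulVf// powRr1//.
by apply: sumr_ge0 => i _; exact: powR_ge0.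
Qed.

Lemma coord_le_ellp_norm p v i : (0 < p)%E -> `|v 0 i| <= ellp_norm p v.
Proof.
case: p => [r||] //= r0; last exact: le_bigmax.
rewrite lte_fin in r0.
rewrite -[leLHS](@powRr1 R) // -[X in _ `^ X](@mulfV _ r) ?gt_eqF// powRrM.
apply: ge0_ler_powR; rewrite ?invr_ge0 ?(ltW r0) ?nnegrE ?powR_ge0//.
  by apply: sumr_ge0 => j _; exact: powR_ge0.
by rewrite (bigD1 i)//= lerDl sumr_ge0// => j _; exact: powR_ge0.
Qed.

(** For finite p = r, every |v_i| is at most M = |v|_q, so |v_i|^r <= |v_i|^q M^(r-q), and summing
    over i gives M^r. For p = oo the coordinate bound is enough. *)
Lemma le_ellp_norm q p v : 0 < q -> (q%:E <= p)%E ->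
  ellp_norm p v <= ellp_norm q%:E v.
Proof.
move=> q0; case: p => [r||]; last by []; last first.
  move=> _ /=; apply/bigmax_leP; split => [|i _]; first exact: powR_ge0.
  exact: (@coord_le_ellp_norm q%:E).
rewrite lee_fin => qr; have r0 : 0 < r by exact: lt_le_trans qr.
set M := ellp_norm q%:E v; have M0 : 0 <= M := ellp_norm_ge0 _ _.
rewrite /= -[leRHS](@powRr1 R) // -[X in M `^ X](@mulfV _ r) ?gt_eqF// powRrM.
apply: ge0_ler_powR; rewrite ?invr_ge0 ?(ltW r0) ?nnegrE ?powR_ge0//.
  by apply: sumr_ge0 => j _; exact: powR_ge0.
have pw (x : R) : x `^ r = x `^ q * x `^ (r - q).
  by rewrite -powRD ?subrKC// gt_eqF.
rewrite pw ellp_norm_powR ?gt_eqF// mulr_suml ler_sum// => i _.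
rewrite pw ler_wpM2l ?powR_ge0// ge0_ler_powR ?subr_ge0 ?nnegrE//.
exact: (@coord_le_ellp_norm q%:E).
Qed.

(** The power mean inequality, source of the factor d^|1/p-1/2|. For p = oo each term of the sum is
    at most |v|_oo^q; for finite p it is Jensen's inequality for t^(r/q), proved through tangents at
    1. *)
Lemma ellp_norm_power_mean q p v : 0 < q -> (q%:E <= p)%E ->
  ellp_norm q%:E v <= d%:R `^ (q^-1 - fine (p^-1)%E) * ellp_norm p v.
Proof.
move=> q0; case: p => [r||] //; last first.
  move=> _; rewrite invey /fine subr0; set M := ellp_norm +oo%E v.
  have M0 : 0 <= M := ellp_norm_ge0 _ _.
  have -> : M = (M `^ q) `^ q^-1 by rewrite -powRrM mulfV ?gt_eqF// powRr1.
  rewrite -powRM ?powR_ge0// ge0_ler_powR ?invr_ge0 ?(ltW q0) ?nnegrE//.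
  - by apply: sumr_ge0 => j _; exact: powR_ge0.
  - by rewrite mulr_ge0 ?powR_ge0.
  rewrite mulr_natl -[X in _ *+ X]card_ord -sumr_const ler_sum// => i _.
  rewrite ge0_ler_powR ?nnegrE// ?(ltW q0)//.
  exact: (@coord_le_ellp_norm +oo%E).
rewrite lee_fin => qr; have r0 : 0 < r by exact: lt_le_trans qr.
rewrite inver gt_eqF//=.
set S := \sum_(i < d) `|v 0 i| `^ r.
(* The normalisation below divides by the mean of the |v_i|^r, so the case S = 0, that is v = 0, is
   settled first. Once S > 0, the sum is nonempty and d > 0. *)
have : 0 <= S by apply: sumr_ge0 => j _; exact: powR_ge0.
rewrite le_eqVlt => /predU1P[/esym/eqP|S0].
  rewrite psumr_eq0 => [/allP v0|i _]; last exact: powR_ge0.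
  rewrite big1 ?powR0 ?invr_neq0 ?(gt_eqF q0)// ?mulr_ge0 ?powR_ge0// => i _.
  have /= := v0 i; rewrite mem_index_enum => /(_ isT)/eqP/powR_eq0_eq0 ->.
  by rewrite powR0 ?gt_eqF.
have d0 : (0 < d%:R :> R).
  rewrite ltr0n lt0n; apply/eqP => d0; move: S0; rewrite /S big1 ?ltxx// => i _.
  by move: (ltn_ord i); rewrite [X in (_ < X)%N]d0.
(* With c the mean of the |v_i|^r, add up the tangent inequalities at 1 for
   x_i = |v_i|^q / c^(q/r), whose powers x_i^(r/q) have mean 1. *)
set c := S / d%:R; have c0 : 0 < c by rewrite divr_gt0.
have cq0 : 0 < c `^ (q / r) by exact: powR_gt0.
pose x i := `|v 0 i| `^ q / c `^ (q / r).
have xr i : x i `^ (r / q) = `|v 0 i| `^ r / c.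
  rewrite powRM ?invr_ge0 ?powR_ge0// -powRrM mulrCA mulfV ?gt_eqF// mulr1.
  congr (_ * _); rewrite -powR_inv1 ?powR_ge0// -!powRrM.
  have -> : q / r * (- 1 * (r / q)) = - 1 by field; rewrite !gt_eqF.
  by rewrite powR_inv1 ?(ltW c0).
have x0 i : 0 <= x i by rewrite divr_ge0 ?powR_ge0.
have sx : \sum_i x i <= d%:R.
  rewrite -subr_le0 -(@pmulr_rle0 _ (r / q)) ?divr_gt0//.
  have -> : (\sum_i x i) - d%:R = \sum_i (x i - 1).
    by rewrite sumrB sumr_const card_ord.
  rewrite mulr_sumr (@le_trans _ _ (\sum_i (x i `^ (r / q) - 1)))//.
    apply: ler_sum => i _; apply: powR_ge_tangent => //.
    by rewrite ler_pdivlMr ?mul1r.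
  under eq_bigr do rewrite xr.
  rewrite sumrB sumr_const card_ord -mulr_suml -/S /c invf_div mulrCA.
  by rewrite mulfV ?gt_eqF// mulr1 subrr.
(* In terms of v this says that the sum of the |v_i|^q is at most d c^(q/r). Its q-th root, with c =
   S/d, has the exponent 1/q - 1/r on d. *)
rewrite -mulr_suml ler_pdivrMr// in sx.
apply: (@le_trans _ _ ((d%:R * c `^ (q / r)) `^ q^-1)).
  rewrite ge0_ler_powR ?invr_ge0 ?(ltW q0) ?nnegrE//.
  - by apply: sumr_ge0 => j _; exact: powR_ge0.
  - by rewrite mulr_ge0 ?powR_ge0// ltW.
rewrite powRM ?powR_ge0 ?(ltW d0)// -powRrM mulrAC mulfV ?gt_eqF// mul1r.
rewrite /c powRM ?invr_ge0 ?(ltW S0) ?(ltW d0)// mulrCA mulrC.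
rewrite -(@powR_inv1 _ d%:R) ?(ltW d0)// -powRrM mulN1r.
by rewrite -powRD ?(gt_eqF d0) ?implybT.
Qed.

Lemma ellp_norm2_sqr v : ellp_norm 2%:E v ^+ 2 = \sum_(i < d) (v 0 i) ^+ 2.
Proof.
rewrite -powR_mulrn ?ellp_norm_ge0// ellp_norm_powR//.
by apply: eq_bigr => i _; rewrite powR_mulrn// real_normK ?num_real.
Qed.

End ellp_norm_comparison.

(** * Norms of basis vectors, sign vectors and zero *)

Lemma ellp_norm_delta (R : realType) (k : nat) (p : \bar R) (i : 'I_k) :
  (1 <= p)%E -> ellp_norm p (delta_mx 0 i : 'rV[R]_k) = 1.
Proof.
case: p => [r| |]// p1.
  have r0 : 0 < r by exact: lt_le_trans (ltr01 : 0 < 1 :> R) p1.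
  rewrite /= (bigD1 i)//= big1 ?mxE ?eqxx ?normr1 ?addr0 ?powR1// => j ji.
  by rewrite mxE (negbTE ji) andbF normr0 powR0 ?gt_eqF.
apply/eqP; rewrite eq_le; apply/andP; split.
  apply/bigmax_leP; split => // j _; rewrite mxE.
  by case: (_ && _); rewrite ?normr1 ?normr0.
have := @coord_le_ellp_norm R k +oo%E (delta_mx 0 i) i.
by rewrite mxE !eqxx normr1; apply.
Qed.

(** Since [fine (p^-1)] is 0 at p = oo, one formula covers both cases. Positivity of k matters
    there: the empty maximum is 0, whereas k^0 = 1. *)
Lemma ellp_norm_unimodular (R : realType) (k : nat) (p : \bar R) (v : 'rV[R]_k) :
  (0 < k)%N -> (1 <= p)%E -> (forall i, `|v 0 i| = 1) ->
  ellp_norm p v = k%:R `^ fine (p^-1)%E.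
Proof.
move=> k0; case: p => [r| |]// p1 v1.
  have r0 : 0 < r by exact: lt_le_trans (ltr01 : 0 < 1 :> R) p1.
  rewrite inver gt_eqF//=; under eq_bigr do rewrite v1 powR1.
  by rewrite sumr_const card_ord.
rewrite invey powRr0; apply/eqP; rewrite eq_le; apply/andP; split.
  by apply/bigmax_leP; split => // j _; rewrite v1.
by rewrite -(v1 (Ordinal k0)); exact: (@coord_le_ellp_norm _ _ +oo%E).
Qed.

Lemma ellp_norm_eq0 (R : realType) (k : nat) (p : \bar R) (v : 'rV[R]_k) :
  (0 < p)%E -> ellp_norm p v = 0 -> v = 0.
Proof.
move=> p0 v0; apply/rowP => i; apply/eqP; rewrite mxE -normr_eq0 eq_le normr_ge0.
by rewrite andbT -v0 coord_le_ellp_norm.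
Qed.

Lemma ellp_norm0 (R : realType) (k : nat) (p : \bar R) :
  (0 < p)%E -> ellp_norm p (0 : 'rV[R]_k) = 0.
Proof.
case: p => [r| |]//=; first rewrite lte_fin => r0.
  rewrite big1 ?powR0 ?invr_neq0 ?gt_eqF// => i _.
  by rewrite mxE normr0 powR0 ?gt_eqF.
move=> _; apply/eqP; rewrite eq_le (@ellp_norm_ge0 _ _ +oo%E) andbT.
by apply/bigmax_leP; split => // i _; rewrite mxE normr0.
Qed.

(** * An isometric copy of l_p^k in L_p, up to scaling *)

Section step_functions.
Context d (T : measurableType d) (R : realType) (k : nat).
Variables (mu : {measure set T -> \bar R}) (A : 'I_k -> set T).

Definition step_fun (v : 'rV[R]_k) (x : T) : R := \sum_i v 0 i * \1_(A i) x.

Hypothesis trivA : trivIset setT A.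

Lemma step_fun_in (v : 'rV[R]_k) i x : A i x -> step_fun v x = v 0 i.
Proof.
move=> Aix; rewrite /step_fun (bigD1 i)//= indicE mem_set// mulr1.
rewrite big1 ?addr0// => j ji; rewrite indicE memNset ?mulr0// => Ajx.
by move/eqP: ji; apply; apply: trivA => //; exists x.
Qed.

Lemma step_fun_notin (v : 'rV[R]_k) x : (forall i, ~ A i x) -> step_fun v x = 0.
Proof. by move=> nA; rewrite /step_fun big1// => i _; rewrite indicE memNset ?mulr0. Qed.

Lemma step_fun_linear a u v x :
  step_fun (a *: u + v) x = a * step_fun u x + step_fun v x.
Proof.
rewrite /step_fun mulr_sumr -big_split/=; apply: eq_bigr => i _.
by rewrite !mxE mulrDl mulrA.
Qed.

Hypothesis mA : forall i, measurable (A i).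

Lemma measurable_step_fun v : measurable_fun setT (step_fun v).
Proof. by apply: measurable_sum => i; exact: measurable_funM. Qed.

(** By disjointness |f|^p is the sum of the |v_i|^p 1_(A_i), whose integral is c times the sum of
    the |v_i|^p. At p = oo the positive measure of each A_i makes every |v_i| visible to the
    essential supremum. *)
Lemma Lnorm_step_fun (c : R) (p : \bar R) v : (0 < k)%N -> 0 < c ->
    (forall i, mu (A i) = c%:E) -> (1 <= p)%E ->
  'N[mu]_p[EFin \o step_fun v]%E = (c `^ fine (p^-1)%E * ellp_norm p v)%:E.
Proof.
move=> k0 c0 muA; rewrite unlock; case: p => [r| |]//.
- rewrite lee_fin => r1; have r0 : 0 < r by exact: lt_le_trans r1.
  rewrite inver gt_eqF//= -powRM ?(ltW c0)//; last first.
    by apply: sumr_ge0 => i _; exact: powR_ge0.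
  rewrite -poweR_EFin; congr (_ `^ _)%E.
  transitivity (\int[mu]_x (\sum_(i < k) (`|v 0 i| `^ r)%:E * (\1_(A i) x)%:E))%E.
    apply: eq_integral => x _; rewrite /= sumEFin; congr EFin.
    have [[i Aix]|nA] := pselect (exists i, A i x).
      rewrite (step_fun_in _ Aix) (bigD1 i)//= indicE mem_set// mulr1.
      rewrite big1 ?addr0// => j ji; rewrite indicE memNset ?mulr0// => Ajx.
      by move/eqP: ji; apply; apply: trivA => //; exists x.
    rewrite step_fun_notin; last by move=> i Aix; apply: nA; exists i.
    rewrite normr0 powR0 ?gt_eqF// big1// => i _.
    by rewrite indicE memNset ?mulr0// => Aix; apply: nA; exists i.
  rewrite ge0_integral_sum//; last first.
  + by move=> i; apply: measurable_funeM; apply/measurable_EFinP.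
  transitivity (\sum_(i < k) (`|v 0 i| `^ r * c)%:E)%E; last first.
    by rewrite sumEFin -mulr_suml mulrC.
  apply: eq_bigr => i _.
  rewrite ge0_integralZl ?lee_fin ?powR_ge0//; last by apply/measurable_EFinP.
  by rewrite integral_indic// setIT muA.
- move=> _; rewrite invey powRr0 mul1r.
  (* The norm at oo is defined by cases on whether the whole space has positive measure; one cell
     suffices to show that it does. *)
  have muT : (0 < mu setT)%E.
    apply: (@lt_le_trans _ _ (mu (A (Ordinal k0)))); first by rewrite muA lte_fin.
    by apply: le_measure; rewrite ?inE.
  rewrite muT; apply/eqP; rewrite eq_le; apply/andP; split.
    apply/ess_supP; apply: aeW => x /=; rewrite lee_fin.
    have [[i Aix]|nA] := pselect (exists i, A i x).
      by rewrite (step_fun_in _ Aix); exact: (@coord_le_ellp_norm _ _ +oo%E).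
    rewrite step_fun_notin; last by move=> i Aix; apply: nA; exists i.
    by rewrite normr0 (@ellp_norm_ge0 _ _ +oo%E).
  set e := ess_sup _ _.
  have vi i : ((`|v 0 i|)%:E <= e)%E.
    (* If e < |v_i|, all of A_i lies in a null set off which |f| <= e, contradicting c > 0. *)
    rewrite leNgt; apply/negP => ev.
    have [B [mB B0 subB]] := @ess_sup_ge _ _ _ mu (abse \o (EFin \o step_fun v)).
    have : (mu (A i) <= mu B)%E.
      apply: le_measure; rewrite ?inE// => x Aix; apply: subB => /=.
      by rewrite (step_fun_in _ Aix) => /le_lt_trans/(_ ev); rewrite ltxx.
    by rewrite muA B0 lee_fin leNgt c0.
  have e0 : (0 <= e)%E by apply: le_trans (vi (Ordinal k0)); rewrite lee_fin.
  rewrite /ellp_norm; elim/big_ind: _ => // x y xe ye.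
  by rewrite EFin_max ge_max xe.
Qed.

End step_functions.

(** The cells are the k intervals [i/k, (i+1)/k), half-open so as to be disjoint. Their common
    measure 1/k gives the scaling constant k^(-1/p). *)
Lemma ellp_embeds_in_Lp (R : realType) (p : \bar R) (p1 : (1 <= p)%E) (k : nat) :
  (0 < k)%N ->
  exists2 c : R, 0 < c & exists Phi : {linear 'rV[R]_k -> Lp p1},
    forall v, Lp_norm (Phi v) = c * ellp_norm p v.
Proof.
move=> k0; have kR0 : 0 < k%:R :> R by rewrite ltr0n.
pose A (i : 'I_k) : set (measurableTypeR R) := `[i%:R / k%:R, i.+1%:R / k%:R[%classic.
have mA i : measurable (A i) by exact: measurable_itv.
have AP i x : A i x <-> i%:R / k%:R <= x < i.+1%:R / k%:R by rewrite /A /= in_itv.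
have trivA : trivIset setT A.
  move=> i j _ _ [x [/AP/andP[xi ix] /AP/andP[xj jx]]].
  (* If cells a and b share a point, then a < b + 1; applied both ways this gives equality of the
     indices. *)
  have h (a b : nat) : a%:R / k%:R <= x -> x < b.+1%:R / k%:R -> (a <= b)%N.
    move=> ax xb; have := le_lt_trans ax xb.
    by rewrite ltr_pM2r ?invr_gt0// ltr_nat.
  by apply/val_inj/anti_leq; rewrite !h.
have muA i : lebesgue01 (A i) = (k%:R^-1)%:E.
  rewrite /lebesgue01 /mrestr setIidl; last first.
    move=> x /AP/andP[ix xi] /=; rewrite in_itv/= (le_trans _ ix) ?divr_ge0//=.
    by rewrite (le_trans (ltW xi))// ler_pdivrMr// mul1r ler_nat.
  rewrite /A lebesgue_measure_itv/= lte_fin ltr_pM2r ?invr_gt0// ltr_nat ltnSn.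
  by rewrite -EFinB -mulrBl -natrB// subSnn mul1r.
have kV0 : 0 < k%:R^-1 :> R by rewrite invr_gt0.
have norm v := Lnorm_step_fun trivA mA v k0 kV0 muA p1.
have Lf v : step_fun A v \in Lfun (@lebesgue01 R) p.
  rewrite !inE/=; apply/andP; split; rewrite inE/=; first exact: measurable_step_fun.
  by rewrite /finite_norm norm ltry.
pose phi v : Lp p1 := Lspace_class (Lfun_Sub p1 (Lf v)).
have phi_lin : linear phi.
  move=> a u v; rewrite /phi -linearP; congr Lspace_class.
  by apply/LfuneqP => x; exact: step_fun_linear.
pose phiL := GRing.isLinear.Build R _ _ _ phi phi_lin.
pose Phi : {linear 'rV[R]_k -> Lp p1} := HB.pack phi phiL.
exists (k%:R^-1 `^ fine (p^-1)%E); first exact: powR_gt0.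
exists Phi => v; apply: EFin_inj.
rewrite -norm; exact: (Lspace_norm_class (Lfun_Sub p1 (Lf v))).
Qed.

(** * Hadamard matrices and the distortion bound for matrices *)

Definition hadamard (R : realType) (k : nat) (H : 'M[R]_k) : Prop :=
  (forall i j, `|H i j| = 1) /\ H^T *m H = (k%:R)%:M.

(** Sylvester's doubling, starting from the 1 x 1 identity. *)
Lemma hadamard_exists (R : realType) (N : nat) :
  exists k, (N <= k)%N /\ exists H : 'M[R]_k, hadamard H.
Proof.
(* Positivity of k is carried along the induction so that doubling k raises it by at least 1. *)
suff [k [Nk k0 hH]] : exists k, [/\ (N <= k)%N, (0 < k)%N &
    exists H : 'M[R]_k, hadamard H] by exists k.
elim: N => [|N [k [Nk k0 [H [Habs HtH]]]]].
  exists 1%N; split => //; exists 1%:M; split => [i j|].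
    by rewrite !ord1 mxE normr1.
  by rewrite trmx1 mulmx1.
exists (k + k)%N; split; [by rewrite -addn1 leq_add|by rewrite addn_gt0 k0|].
exists (block_mx H H H (- H)); split => [i j|].
  by rewrite !mxE; do 2 (case: splitP => ? _; rewrite ?mxE); rewrite ?normrN Habs.
rewrite tr_block_mx mulmx_block !linearN/= ?mulNmx ?mulmxN ?linearN/= ?opprK HtH subrr.
by rewrite natrD -raddfD/= -scalar_mx_block.
Qed.

(** The sum of squared row norms of B is tr(B^T B), and (HA)^T (HA) = A^T (H^T H) A = k A^T A. *)
Lemma hadamard_parseval (R : realType) (k d : nat) (H : 'M[R]_k)
    (A : 'M[R]_(k, d)) : hadamard H ->
  \sum_i ellp_norm 2%:E (row i (H *m A)) ^+ 2 =
  k%:R * \sum_i ellp_norm 2%:E (row i A) ^+ 2.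
Proof.
have frob (B : 'M[R]_(k, d)) :
    \sum_i ellp_norm 2%:E (row i B) ^+ 2 = \tr (B^T *m B).
  under eq_bigr do rewrite ellp_norm2_sqr.
  rewrite /mxtrace exchange_big/=; apply: eq_bigr => j _; rewrite mxE.
  by apply: eq_bigr => i _; rewrite !mxE expr2.
move=> [_ HtH].
rewrite [LHS]frob [X in _ * X]frob trmx_mul mulmxA -(mulmxA A^T) HtH.
by rewrite mul_mx_scalar -scalemxAl mxtraceZ.
Qed.

(** The rows of [A] stand for the images of the e_l, those of [H *m A] for the images of the w_i,
    and [K] is the l_p norm of w_i. Parseval is played against a lower bound on one family and an
    upper bound on the other; which one depends on the side of 2 on which p lies. *)
Lemma hadamard_distortion (R : realType) (k d : nat) (H : 'M[R]_k)
    (A : 'M[R]_(k, d)) (p : \bar R) (s D : R) :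
  (0 < k)%N -> (0 < d)%N -> (1 <= p)%E -> hadamard H -> 0 < s -> 0 <= D ->
  let K := k%:R `^ fine (p^-1)%E in
  (forall i, s <= ellp_norm p (row i A) <= D * s) ->
  (forall i, s * K <= ellp_norm p (row i (H *m A)) <= D * s * K) ->
  (k%:R / d%:R) `^ `|fine (p^-1)%E - 2^-1| <= D.
Proof.
move=> k0 d0 p1 hH s0 D0 K hA hHA.
have kR0 : 0 < k%:R :> R by rewrite ltr0n.
have dR0 : 0 < d%:R :> R by rewrite ltr0n.
have parseval := hadamard_parseval A hH.
set a := `|_|.
have da0 : 0 < d%:R `^ a :> R by exact: powR_gt0.
have K0 : 0 < K by exact: powR_gt0.
have sqrt_k : k%:R = (k%:R `^ 2^-1) ^+ 2 :> R.
  by rewrite -powR_mulrn ?powR_ge0// -powRrM mulVf// powRr1// ltW.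
have kh0 : 0 < k%:R `^ 2^-1 :> R by exact: powR_gt0.
have suff_bound : k%:R `^ a <= d%:R `^ a * D -> (k%:R / d%:R) `^ a <= D.
  rewrite powRM ?invr_ge0 ?(ltW kR0) ?(ltW dR0)// => kdD.
  rewrite -(@powR_inv1 _ d%:R) ?(ltW dR0)// -powRrM mulN1r powRN.
  by rewrite ler_pdivrMr// mulrC.
apply: suff_bound.
have sum_cst (x : R) : \sum_(i < k) x = k%:R * x.
  by rewrite sumr_const card_ord mulr_natl.
have [p2|p2] := leP 2%:E p.
- have ip : fine (p^-1)%E <= 2^-1.
    case: p p1 p2 {hA hHA K K0 a da0} => [r| |]//= p1 p2.
    rewrite lee_fin in p2.
    rewrite inver gt_eqF ?(lt_le_trans _ p2)//= lef_pV2 ?posrE//.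
    exact: lt_le_trans p2.
  have aE : a = 2^-1 - fine (p^-1)%E by rewrite /a ler0_norm ?subr_le0// opprB.
  (* For p >= 2 one has |.|_p <= |.|_2 <= d^a |.|_p. The lower bound on the rows of [A] and the
     upper bound on those of [H *m A] are squared and summed over the k rows, whence the
     multiplication by k. *)
  have key : k%:R `^ 2^-1 * s <= d%:R `^ a * (D * s * K).
    rewrite -ler_sqr ?nnegrE ?mulr_ge0 ?(ltW s0) ?(ltW K0) ?(ltW da0) ?(ltW kh0)//.
    rewrite exprMn -sqrt_k -(ler_pM2l kR0) -[leRHS]sum_cst -(sum_cst (s ^+ 2)).
    apply: (@le_trans _ _ (k%:R * \sum_i ellp_norm 2%:E (row i A) ^+ 2)).
      rewrite ler_pM2l// ler_sum// => i _.
      rewrite ler_sqr ?nnegrE ?ellp_norm_ge0 ?(ltW s0)//.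
      have /andP[+ _] := hA i; move/le_trans; apply.
      exact: le_ellp_norm.
    rewrite -parseval ler_sum// => i _.
    rewrite ler_sqr ?nnegrE ?ellp_norm_ge0 ?mulr_ge0 ?(ltW s0) ?(ltW K0) ?(ltW da0)//.
    apply: le_trans (ellp_norm_power_mean _ _ p2) _ => //.
    rewrite -aE ler_pM2l//.
    by have /andP[] := hHA i.
  have kE : k%:R `^ 2^-1 = k%:R `^ a * K.
    by rewrite /K -powRD ?aE ?subrK ?(gt_eqF kR0) ?implybT.
  rewrite kE in key.
  rewrite -(ler_pM2r (mulr_gt0 s0 K0)).
  by rewrite [leLHS]mulrA [leLHS]mulrAC -[leRHS]mulrA [D * _]mulrA.
- have [r pr] : exists r, p = r%:E.
    by case: p p1 p2 {hA hHA K K0 a da0} => [r| |]// _ _; exists r.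
  have r1 : 1 <= r by rewrite -lee_fin -pr.
  have r2 : r < 2 by rewrite -lte_fin -pr.
  have r0 : 0 < r by exact: lt_le_trans r1.
  have aE : a = fine (p^-1)%E - 2^-1.
    rewrite /a ger0_norm// pr inver gt_eqF//= subr_ge0 lef_pV2 ?posrE//.
    exact: ltW.
  (* For p < 2 the comparison of norms is reversed, |.|_2 <= |.|_p <= d^a |.|_2, so the lower bound
     is taken on [H *m A] and the upper bound on [A]. *)
  have key : s * K <= d%:R `^ a * (k%:R `^ 2^-1 * (D * s)).
    rewrite -ler_sqr ?nnegrE ?mulr_ge0 ?(ltW s0) ?(ltW K0) ?(ltW da0) ?(ltW kh0)//.
    rewrite [leRHS]exprMn [(_ * (D * s)) ^+ 2]exprMn -sqrt_k -(ler_pM2l kR0).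
    rewrite [leRHS]mulrCA -(sum_cst ((s * K) ^+ 2)).
    apply: (@le_trans _ _ (\sum_i (d%:R `^ a * ellp_norm 2%:E (row i (H *m A))) ^+ 2)).
      apply: ler_sum => i _.
      rewrite ler_sqr ?nnegrE ?mulr_ge0 ?ellp_norm_ge0 ?(ltW s0) ?(ltW K0) ?(ltW da0)//.
      have /andP[+ _] := hHA i; move/le_trans; apply.
      have := @ellp_norm_power_mean R d r 2%:E (row i (H *m A)) r0.
      rewrite aE pr lee_fin !inver pnatr_eq0 !(gt_eqF r0)/=; apply; exact: ltW.
    rewrite [leLHS](eq_bigr _ (fun i _ => exprMn _ _ _)) -mulr_sumr parseval.
    rewrite ler_pM2l ?exprn_gt0// ler_pM2l// -sum_cst.
    apply: ler_sum => i _.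
    rewrite ler_sqr ?nnegrE ?ellp_norm_ge0 ?mulr_ge0 ?(ltW s0)//.
    have /andP[_] := hA i; apply: le_trans.
    by rewrite pr; apply: le_ellp_norm => //; rewrite lee_fin ltW.
  have KE : K = k%:R `^ a * k%:R `^ 2^-1.
    by rewrite /K -powRD ?aE ?subrK ?(gt_eqF kR0) ?implybT.
  rewrite KE in key.
  rewrite -(ler_pM2r (mulr_gt0 s0 kh0)).
  by rewrite [leLHS]mulrCA -[leRHS]mulrA [D * _]mulrA [D * s * _]mulrC.
Qed.

(** * The point set and the lower bound in L_p *)

Definition hadamard_points (R : realType) (k : nat) (H : 'M[R]_k)
    (t : option ('I_k + 'I_k)) : 'rV[R]_k :=
  match t with
  | None => 0
  | Some (inl i) => delta_mx 0 i
  | Some (inr i) => row i H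
  end.

(** The rows of H are distinct because H has inverse H^T / k. They have no zero entry, while for k >
    1 every basis vector has one; for k = 1 the two families could meet. *)
Lemma hadamard_points_inj (R : realType) (k : nat) (H : 'M[R]_k) :
  (1 < k)%N -> hadamard H -> injective (hadamard_points H).
Proof.
move=> k1 [Habs HtH].
have k0 : k%:R != 0 :> R by rewrite pnatr_eq0 -lt0n ltnW.
pose Hinv := k%:R^-1 *: H^T.
have HHinv : H *m Hinv = 1%:M.
  by apply: mulmx1C; rewrite -scalemxAl HtH scale_scalar_mx mulVf.
have delta_inj (i j : 'I_k) : delta_mx 0 i = delta_mx 0 j :> 'rV[R]_k -> i = j.
  move=> /rowP/(_ i); rewrite !mxE !eqxx/=.
  by case: eqVneq => // _ /eqP; rewrite oner_eq0.
have row_neq0 i j : row i H 0 j != 0 by rewrite mxE -normr_eq0 Habs oner_eq0.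
have row_inj i j : row i H = row j H -> i = j.
  rewrite !rowE => /(congr1 (mulmx^~ Hinv)); rewrite -!mulmxA HHinv !mulmx1.
  exact: delta_inj.
have delta_neq0 (i : 'I_k) : delta_mx 0 i != 0 :> 'rV[R]_k.
  by apply/eqP => /rowP/(_ i)/eqP; rewrite !mxE !eqxx oner_eq0.
have row_delta i j : row i H != delta_mx 0 j.
  have [l lj] : exists l, l != j.
    exists (if j == Ordinal k1 then Ordinal (ltnW k1) else Ordinal k1).
    by case: ifPn => [/eqP -> //|]; rewrite eq_sym.
  apply/eqP => /rowP/(_ l)/eqP; rewrite [X in _ == X]mxE (negbTE lj) andbF.
  by rewrite (negbTE (row_neq0 i l)).
have row_neq i : row i H != 0.
  apply/eqP => /rowP/(_ i)/eqP; rewrite [X in _ == X]mxE.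
  by rewrite (negbTE (row_neq0 i i)).
move=> [[i|i]|] [[j|j]|] //= /eqP.
- by move=> /eqP/delta_inj ->.
- by rewrite eq_sym (negbTE (row_delta _ _)).
- by rewrite (negbTE (delta_neq0 _)).
- by rewrite (negbTE (row_delta _ _)).
- by move=> /eqP/row_inj ->.
- by rewrite (negbTE (row_neq _)).
- by rewrite eq_sym (negbTE (delta_neq0 _)).
- by rewrite eq_sym (negbTE (row_neq _)).
Qed.

Theorem mainTheorem7 (R : realType) (p : \bar R) (p1 : (1 <= p)%E) (N : nat) :
  exists2 n : nat, (N <= n)%N &
  exists2 X : set (Lp p1), (X #= `I_n)%card &
  forall (d : nat) (T : {linear Lp p1 -> 'rV[R]_d}), (0 < d)%N ->
    ((((n%:R - 1) / (2 * d%:R)) `^ `|fine (p^-1)%E - 2^-1|)%:E <=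
       distortion Lp_norm (ellp_norm p) X T)%E.
Proof.
(* The shift by 2 provides k > 1, needed for the 2k+1 points to be distinct. *)
have [k [Nk [H hH]]] := hadamard_exists R N.+2.
have k1 : (1 < k)%N by exact: leq_ltn_trans Nk.
have k0 : (0 < k)%N by exact: ltnW.
have [c c0 [Phi normPhi]] := ellp_embeds_in_Lp p1 k0.
have p0 : (0 < p)%E by exact: (lt_le_trans lte01 p1).
have Phi_inj : injective Phi.
  move=> u v uv; apply/subr0_eq/(@ellp_norm_eq0 _ _ p) => //.
  apply: (mulfI (lt0r_neq0 c0)); rewrite -normPhi linearB uv -(linearB Phi) subrr.
  by rewrite normPhi ellp_norm0// mulr0.
pose point (i : 'I_#|{: option ('I_k + 'I_k)}|) := hadamard_points H (enum_val i).
have card_points : #|{: option ('I_k + 'I_k)}| = (k + k).+1.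
  by rewrite card_option card_sum card_ord.
exists #|{: option ('I_k + 'I_k)}|.
  by rewrite card_points (leq_trans (ltnW (ltnW Nk)))// -addnS leq_addr.
exists (range (Phi \o point)).
  apply: card_eq_trans (card_esym card_II); apply: inj_card_eq; apply: in2W.
  apply: inj_comp Phi_inj _.
  exact: inj_comp (hadamard_points_inj k1 hH) enum_val_inj.
(* The distortion is an infimum, so it is enough to bound each admissible D. With n - 1 = 2k the
   base of the power becomes k/d. *)
move=> d T d0; apply: le_ereal_inf_tmp => _ [D [s s0 hD] <-]; rewrite lee_fin.
rewrite card_points; have -> : ((k + k).+1%:R - 1) / (2 * d%:R) = k%:R / d%:R :> R.
  rewrite -addn1 !natrD addrK; field.
  by rewrite pnatr_eq0 -lt0n.
pose A := lin1_mx (T \o Phi).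
(* Only pairs containing the point 0 of X are used, which turns distances into norms; the scale c of
   the embedding is absorbed into s. *)
have hD0 t : let v := hadamard_points H t in
    s * c * ellp_norm p v <= ellp_norm p (v *m A) <= D * (s * c) * ellp_norm p v.
  move=> v; have := hD (Phi v) (Phi 0).
  rewrite linear0 subr0 linear0 subr0 normPhi !mulrA mul_rV_lin1/=.
  apply; first by exists (enum_rank t); rewrite //= /point enum_rankK.
  by exists (enum_rank None); rewrite //= /point enum_rankK/= linear0.
have hA i : s * c <= ellp_norm p (row i A) <= D * (s * c).
  by have := hD0 (Some (inl i)); rewrite /= ellp_norm_delta// !mulr1 -rowE.
apply: (hadamard_distortion k0 d0 p1 hH (mulr_gt0 s0 c0) _ hA).
  (* The two bounds on a single row force D >= 1, hence D >= 0. *)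
  have /andP[lo hi] := hA (Ordinal k0).
  have := le_trans lo hi; rewrite -[leLHS]mul1r ler_pM2r ?mulr_gt0//.
  exact: le_trans.
move=> i; have := hD0 (Some (inr i)).
rewrite /= (ellp_norm_unimodular k0 p1); first by rewrite row_mul.
by move=> j; rewrite mxE (proj1 hH).
Qed.
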